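(* Let $\mathfrak{g}$ be a filiform $(2p+1)$-dimensional Lie algebra. Consider an adapted basis $(X_{0},X_{1},\ldots,X_{2p})$ of $\mathfrak{g}$ and its dual basis $(\alpha_{0},\alpha_{1},\ldots,\alpha_{2p})$. If $\alpha=a_{0}\alpha_{0}+a_{1}\alpha_{1}+\cdots+a_{2p}\alpha_{2p}$ is a contact form on $\mathfrak{g}$, then the form $\beta=a_{2p}\alpha_{2p}$ is also a contact form on $\mathfrak{g}$, and $(\mathfrak{g},\alpha)$ is contacto-isomorphic to $(\mathfrak{g},\beta)$.
   Context: Lie algebras are real and finite-dimensional. A Lie algebra $\mathfrak{g}$ of dimension $m\ge 3$ is filiform if $\dim C^{k}\mathfrak{g}=m-k-1$ for $k=1,\ldots,m-1$, where $C^{0}\mathfrak{g}=\mathfrak{g}$ and $C^{i}\mathfrak{g}=[\mathfrak{g},C^{i-1}\mathfrak{g}]$. Put $n=2p$. $\mu_{0}$ denotes the law of the Lie algebra $L_{n}$ with basis $X_{0},\ldots,X_{n}$, whose only nonzero brackets (up to antisymmetry) are $\mu_{0}(X_{0},X_{i})=X_{i+1}$, $i=1,\ldots,n-1$. $\Delta$ is the set of pairs of integers $(k,r)$ with $1\le k\le n-1$, $2k+1<r\le n$, $r\ge 4$. For $(k,r)\in\Delta$, $\Psi_{k,r}$ is the skew-symmetric bilinear map defined by $$\Psi_{k,r}(X_{i},X_{j})=-\Psi_{k,r}(X_{j},X_{i})=(-1)^{k-i}\binom{j-k-1}{k-i}X_{i+j+r-2k-1}$$ if $1\le i\le k<j\le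 n$ and $i+j+r-2k-1\le n$, and $\Psi_{k,r}(X_{i},X_{j})=0$ for all other pairs $i<j$ (in particular whenever $i=0$). Here $\binom{q}{s}=0$ if $q<s$ (or $q<0$). A basis $(X_{0},\ldots,X_{n})$ of an $(n+1)$-dimensional filiform Lie algebra is adapted if its bracket has the form $[X_{i},X_{j}]=\mu_{0}(X_{i},X_{j})+\Psi(X_{i},X_{j})$, $0\le i,j\le n$, with $\Psi=\sum_{(k,r)\in\Delta}a_{k,r}\Psi_{k,r}$ for scalars $a_{k,r}$ (unrelated to the coefficients $a_0,\dots,a_{2p}$ of $\alpha$). A contact form on a $(2p+1)$-dimensional Lie algebra $\mathfrak{g}$ is $\alpha\in\mathfrak{g}^{*}$ with $\alpha\wedge(d\alpha)^{p}\ne 0$, where $d\alpha(x,y)=-\alpha([x,y])$. Lie algebras with contact forms $(\mathfrak{g}_{1},\alpha_{1})$ and $(\mathfrak{g}_{2},\alpha_{2})$ are contacto-isomorphic if there is an isomorphism of Lie algebras $\varphi:\mathfrak{g}_{1}\to\mathfrak{g}_{2}$ with $\varphi^{*}(\alpha_{2})=\alpha_{1}$. *)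

(* Defs.v *)
From HB Require Import structures.
From mathcomp Require Import all_boot all_order all_fingroup all_algebra.
From mathcomp Require Import reals.

Set Implicit Arguments.
Unset Strict Implicit.
Unset Printing Implicit Defensive.
Import Order.TTheory GRing.Theory Num.Theory.
Local Open Scope ring_scope.

(** * Lie algebras *)

HB.mixin Record Vector_isLieAlg (R : fieldType) g of Vector R g := {
  lie : g -> g -> g;
  lie_bilinear : bilinear_for *:%R *:%R lie;
  liexx : forall x, lie x x = 0;
  lie_jacobi : forall x y z,
    lie x (lie y z) + lie y (lie z x) + lie z (lie x y) = 0
}.

#[short(type="lieAlgType")]
HB.structure Definition LieAlg (R : fieldType) :=
  {g of Vector R g & Vector_isLieAlg R g}.

Section LieAlgebra.
Variables (R : fieldType) (g : lieAlgType R).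
Implicit Types (U V W : {vspace g}) (x y : g).

Lemma lie_linearl a x y z : lie (a *: x + y) z = a *: lie x z + lie y z.
Proof. exact: ((@lie_bilinear R g).1 z a x y). Qed.

Lemma lie_linearr a x y z : lie z (a *: x + y) = a *: lie z x + lie z y.
Proof. exact: ((@lie_bilinear R g).2 z a x y). Qed.

Lemma lie0l x : lie 0 x = 0.
Proof. by have := lie_linearl (-1) 0 0 x; rewrite !scaleN1r oppr0 addr0 addNr. Qed.

Lemma lie0r x : lie x 0 = 0.
Proof. by have := lie_linearr (-1) 0 0 x; rewrite !scaleN1r oppr0 addr0 addNr. Qed.

Lemma lieZl a x y : lie (a *: x) y = a *: lie x y.
Proof. by rewrite -[a *: x]addr0 lie_linearl lie0l addr0. Qed.

Lemma lieZr a x y : lie x (a *: y) = a *: lie x y.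
Proof. by rewrite -[a *: y]addr0 lie_linearr lie0r addr0. Qed.

Lemma lie_suml x I (r : seq I) (F : I -> g) :
  lie (\sum_(i <- r) F i) x = \sum_(i <- r) lie (F i) x.
Proof.
elim: r => [|i r IHr]; first by rewrite !big_nil lie0l.
by rewrite !big_cons -IHr -[F i]scale1r lie_linearl !scale1r.
Qed.

Lemma lie_sumr x I (r : seq I) (F : I -> g) :
  lie x (\sum_(i <- r) F i) = \sum_(i <- r) lie x (F i).
Proof.
elim: r => [|i r IHr]; first by rewrite !big_nil lie0r.
by rewrite !big_cons -IHr -[F i]scale1r lie_linearr !scale1r.
Qed.

(* [U, V]. Same rendering as [prodv] for algebras: by bilinearity the brackets
   of bases span the brackets of all elements (see [lievP]). *)
Definition liev U V : {vspace g} := <<allpairs lie (vbasis U) (vbasis V)>>%VS.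

Lemma memv_lie U V : {in U & V, forall x y, lie x y \in liev U V}.
Proof.
move=> x y /coord_vbasis-> /coord_vbasis->.
rewrite lie_suml; apply: rpred_sum => i _.
rewrite lie_sumr; apply: rpred_sum => j _.
rewrite lieZl lieZr !memvZ // memv_span //.
by apply: allpairs_f; apply: memt_nth.
Qed.

Lemma lievP U V W :
  reflect {in U & V, forall x y, lie x y \in W} (liev U V <= W)%VS.
Proof.
apply: (iffP idP) => [sUVW x y Ux Vy | sUVW].
  by apply: (subvP sUVW); apply: memv_lie.
apply/span_subvP => _ /allpairsP[[u v] /= [Uu Vv ->]].
by rewrite sUVW ?vbasis_mem.
Qed.

Fixpoint lower_central (i : nat) : {vspace g} :=
  if i is i'.+1 then liev fullv (lower_central i') else fullv.

Definition filiform : Prop :=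
  let m := \dim {:g} in
  (3 <= m)%N /\
  forall k, (1 <= k <= m - 1)%N -> \dim (lower_central k) = (m - k - 1)%N.

(** * Adapted bases *)

Section AdaptedBasis.
Variables (n : nat) (X : n.+1.-tuple g).

(* [mu0 i j] and [Psi k r i j] are the values of the bilinear maps mu_0 and
   Psi_{k,r} at the pair of basis vectors (X_i, X_j). *)
Definition mu0 (i j : nat) : g :=
  if (i == 0)%N && (1 <= j <= n - 1)%N then X`_j.+1
  else if (j == 0)%N && (1 <= i <= n - 1)%N then - X`_i.+1
  else 0.

Definition Delta (k r : nat) : bool :=
  [&& (1 <= k <= n - 1)%N, (2 * k + 1 < r <= n)%N & (4 <= r)%N].

(* The subtractions on [nat] are never truncated: k < j, i <= k, and
   2k + 1 < r for (k, r) in Delta. *)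
Definition Psi_lt (k r i j : nat) : g :=
  if [&& (1 <= i <= k)%N, (k < j <= n)%N & (i + j + r - 2 * k - 1 <= n)%N]
  then ((-1) ^+ (k - i) * ('C(j - k - 1, k - i))%:R)
         *: X`_(i + j + r - 2 * k - 1)
  else 0.

Definition Psi (k r i j : nat) : g :=
  if (i < j)%N then Psi_lt k r i j
  else if (j < i)%N then - Psi_lt k r j i
  else 0.

Definition adapted_basis : Prop :=
  basis_of fullv X /\
  exists c : nat -> nat -> R, forall i j : 'I_n.+1,
    lie X`_i X`_j =
      mu0 i j + \sum_(k < n.+1) \sum_(r < n.+1 | Delta k r) c k r *: Psi k r i j.

(* Together with [basis_of fullv X] this determines [al]. *)
Definition dual_basis (al : 'I_n.+1 -> 'Hom(g, R^o)) : Prop :=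
  forall i j : 'I_n.+1, al i X`_j = (i == j)%:R.

End AdaptedBasis.
End LieAlgebra.

(** * Exterior forms and contact forms *)

Section Forms.
Variables (R : fieldType) (V : vectType R).

(* Forms of degree k, as functions of k vectors. No alternation is required,
   since [wedge] is only applied below to forms that are alternating. *)
Definition form (k : nat) := ('I_k -> V) -> R.

(* The normalisation 1 / (k! l!) presupposes characteristic 0. *)
Definition wedge k l (w : form k) (t : form l) : form (k + l) := fun v =>
  ((k`! * l`!)%N%:R)^-1 *
  \sum_(s : 'S_(k + l))
    (-1) ^+ s * w (fun i => v (s (lshift l i))) * t (fun j => v (s (rshift k j))).

Fixpoint wedge_exp k (w : form k) (m : nat) : form (m * k) :=
  if m is m'.+1 then wedge w (@wedge_exp k w m') else fun=> 1.

Definition form1 (al : 'Hom(V, R^o)) : form 1 := fun v => al (v ord0).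

End Forms.

Arguments wedge_exp {R V k} w m _.

Section Contact.
Variables (R : fieldType).

Definition d1 (g : lieAlgType R) (al : 'Hom(g, R^o)) : form g 2 :=
  fun v => - al (lie (v ord0) (v ord_max)).

Definition contact_form (p : nat) (g : lieAlgType R) (al : 'Hom(g, R^o)) :=
  \dim {:g} = (2 * p).+1 /\
  exists v, wedge (form1 al) (wedge_exp (d1 al) p) v != 0.

Definition contacto_isomorphic (g1 g2 : lieAlgType R)
    (al1 : 'Hom(g1, R^o)) (al2 : 'Hom(g2, R^o)) : Prop :=
  exists phi : 'Hom(g1, g2),
    [/\ bijective phi,
        forall x y, phi (lie x y) = lie (phi x) (phi y)
      & (al2 \o phi)%VF = al1].

End Contact.

(* Main.v *)
Require Import Defs.
From HB Require Import structures.
From mathcomp Require Import all_boot all_order all_fingroup all_algebra.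
From mathcomp Require Import reals.
From mathcomp Require Import boolp zify.

Set Implicit Arguments.
Unset Strict Implicit.
Unset Printing Implicit Defensive.
Import Order.TTheory GRing.Theory Num.Theory.
Local Open Scope ring_scope.

(* The contact condition says that the radical of d alpha meets ker alpha
   trivially. As X_n is central, it spans that radical, so the tangent space at
   alpha of its coadjoint orbit consists of all forms vanishing at X_n. Since g
   is nilpotent, this makes the orbit the whole affine hyperplane of forms
   taking the value alpha(X_n) at X_n. It contains beta, hence some inner
   automorphism carries alpha to beta. *)

(** * Multilinear forms, wedge products and contraction *)

Section MultilinearForms.
Variables (R : numFieldType) (V : vectType R).

Definition upd (n : nat) (v : 'I_n -> V) (i : 'I_n) (x : V) : 'I_n -> V :=
  fun j => if j == i then x else v j.

Definition multilinear n (w : Defs.form V n) := forall v i c x y,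
  w (upd v i (c *: x + y)) = c * w (upd v i x) + w (upd v i y).

(** This is the condition i_z w = 0, imposed on every slot because a form here need not
    alternate. *)
Definition kills (z : V) n (w : Defs.form V n) :=
  forall v i, v i = z -> w v = 0.

Definition alternating n (w : Defs.form V n) :=
  forall v i j, i != j -> v i = v j -> w v = 0.

Lemma upd_id n (v : 'I_n -> V) i : upd v i (v i) = v.
Proof. by apply/funext => j; rewrite /upd; case: eqP => [->|]. Qed.

Lemma upd_perm n (v : 'I_n -> V) (s : 'S_n) i x :
  upd v (s i) x \o s = upd (v \o s) i x.
Proof. by apply/funext => j; rewrite /upd /= (inj_eq perm_inj). Qed.

Lemma upd_lshift_lshift k l (v : 'I_(k + l) -> V) i x :
  upd v (lshift l i) x \o @lshift k l = upd (v \o @lshift k l) i x.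
Proof. by apply/funext => j; rewrite /upd /= (inj_eq (@lshift_inj _ _)). Qed.

Lemma upd_lshift_rshift k l (v : 'I_(k + l) -> V) i x :
  upd v (lshift l i) x \o @rshift k l = v \o @rshift k l.
Proof. by apply/funext => j; rewrite /upd /= eq_rlshift. Qed.

Lemma upd_rshift_lshift k l (v : 'I_(k + l) -> V) i x :
  upd v (rshift k i) x \o @lshift k l = v \o @lshift k l.
Proof. by apply/funext => j; rewrite /upd /= eq_lrshift. Qed.

Lemma upd_rshift_rshift k l (v : 'I_(k + l) -> V) i x :
  upd v (rshift k i) x \o @rshift k l = upd (v \o @rshift k l) i x.
Proof. by apply/funext => j; rewrite /upd /= (inj_eq (@rshift_inj _ _)). Qed.

Lemma wedgeE k l (w : Defs.form V k) (t : Defs.form V l) v :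
  wedge w t v = ((k`! * l`!)%N%:R)^-1 * \sum_(s : 'S_(k + l))
    (-1) ^+ s * w ((v \o s) \o @lshift k l) * t ((v \o s) \o @rshift k l).
Proof. by []. Qed.

Lemma wedge_multilinear k l (w : Defs.form V k) (t : Defs.form V l) :
  multilinear w -> multilinear t -> multilinear (wedge w t).
Proof.
move=> lin_w lin_t v i c x y; rewrite !wedgeE mulrCA -mulrDr; congr (_ * _).
rewrite mulr_sumr -big_split /=; apply: eq_bigr => s _.
(* Slot [i] of [v] is slot [s^-1 i] of [v \o s], which belongs to exactly one of the two factors. *)
rewrite -[i](permKV s) !upd_perm; set u := v \o s.
case: (split_ordP ((s^-1)%g i)) => j ->.
  rewrite !upd_lshift_lshift !upd_lshift_rshift lin_w.
  by rewrite mulrDr mulrDl mulrCA -!mulrA.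
rewrite !upd_rshift_lshift !upd_rshift_rshift lin_t.
by rewrite mulrDr mulrCA.
Qed.

Lemma wedge_kills z k l (w : Defs.form V k) (t : Defs.form V l) :
  kills z w -> kills z t -> kills z (wedge w t).
Proof.
move=> zw zt v i vi; rewrite wedgeE big1 ?mulr0 // => s _.
have : v (s ((s^-1)%g i)) = z by rewrite permKV.
case: (split_ordP ((s^-1)%g i)) => j -> vj.
  by rewrite (zw _ j) ?mulr0 ?mul0r.
by rewrite (zt _ j) ?mulr0.
Qed.

(** Composing the summation index with the transposition of [i] and [j] fixes [v \o s] and flips the
    sign, so the sum is its own opposite, hence zero in characteristic 0. *)
Lemma wedge_alternating k l (w : Defs.form V k) (t : Defs.form V l) :
  alternating (wedge w t).
Proof.
move=> v i j ij vij; rewrite wedgeE; set S := bigop _ _ _.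
suff SN : S = - S.
  have /eqP : S *+ 2 = 0 by rewrite mulr2n {1}SN addNr.
  by rewrite mulrn_eq0 /= => /eqP ->; rewrite mulr0.
rewrite {1}/S (reindex_inj (mulIg (tperm i j))) -sumrN.
apply: eq_bigr => s _.
have -> : v \o (s * tperm i j)%g = v \o s.
  by apply/funext => m; rewrite /= permM; case: tpermP => // ->.
by rewrite odd_permM odd_tperm ij addbT signrN !mulNr.
Qed.

Lemma wedge_exp_multilinear k (w : Defs.form V k) m :
  multilinear w -> multilinear (wedge_exp w m).
Proof.
move=> lin_w; elim: m => [|m IHm]; first by move=> v [].
exact: wedge_multilinear.
Qed.

Lemma wedge_exp_kills z k (w : Defs.form V k) m :
  kills z w -> kills z (wedge_exp w m).
Proof.
move=> zw; elim: m => [|m IHm]; first by move=> v [].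
exact: wedge_kills.
Qed.

Lemma multilinear0 n (w : Defs.form V n) v i :
  multilinear w -> w (upd v i 0) = 0.
Proof.
by move=> lin_w; have := lin_w v i (-1) 0 0; rewrite scaler0 addr0 mulN1r addNr.
Qed.

Lemma multilinear_sum n (w : Defs.form V n) v i (I : Type) (r : seq I)
    (P : pred I) (c : I -> R) (u : I -> V) : multilinear w ->
  w (upd v i (\sum_(j <- r | P j) c j *: u j)) =
  \sum_(j <- r | P j) c j * w (upd v i (u j)).
Proof.
move=> lin_w; elim: r => [|j r IHr]; first by rewrite !big_nil multilinear0.
by rewrite !big_cons; case: ifP; rewrite ?lin_w IHr.
Qed.

(* If w v != 0 then z :: v is free: putting a linear relation into slot i of v
   leaves only the coefficient of v i, times w v. *)
Lemma alternating_kills_eq0 n (w : Defs.form V n) z v :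
  multilinear w -> alternating w -> kills z w -> (\dim {:V} <= n)%N ->
  w v != 0 -> z = 0.
Proof.
move=> lin_w alt_w zw dimV wv; apply/eqP; apply: contraLR dimV => z0.
rewrite -ltnNge; pose Y := [tuple of z :: [tuple v i | i < n]].
have Y0 : Y`_(@ord0 n) = z by [].
have Yl (i : 'I_n) : Y`_(lift ord0 i) = v i by rewrite lift0 /= (nth_mktuple v).
suff freeY : free Y.
  by have := dimvS (subvf <<Y>>%VS); rewrite (eqnP freeY) size_tuple.
apply/freeP => c cY; have c0 (i : 'I_n) : c (lift ord0 i) = 0.
  have := multilinear_sum v i (index_enum _) xpredT c (fun j => Y`_j) lin_w.
  rewrite cY multilinear0 // big_ord_recl Y0.
  rewrite [w _](zw _ i) ?mulr0 ?add0r; last by rewrite /upd eqxx.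
  rewrite (bigD1 i) // Yl upd_id big1 => [|j ji].
    by rewrite /= addr0 => /esym/eqP; rewrite mulf_eq0 (negPf wv) orbF => /eqP.
  rewrite Yl [w _](alt_w _ i j) ?mulr0 // 1?eq_sym //.
  by rewrite /upd eqxx (negPf ji).
move=> i; case: (unliftP ord0 i) => [j -> //|->].
move: cY; rewrite big_ord_recl Y0 big1 => [|j _]; last by rewrite c0 scale0r.
by rewrite addr0 => /eqP; rewrite scaler_eq0 (negPf z0) orbF => /eqP.
Qed.

(** Naturality of the wedge under pullback, used to transport contact forms along morphisms. *)
Lemma wedge_comp (W : vectType R) (f : V -> W) k l
    (w : Defs.form V k) (t : Defs.form V l)
    (w' : Defs.form W k) (t' : Defs.form W l) :
  (forall v, w' (f \o v) = w v) -> (forall v, t' (f \o v) = t v) ->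
  forall v, wedge w' t' (f \o v) = wedge w t v.
Proof.
move=> ww tt v; rewrite !wedgeE; congr (_ * _); apply: eq_bigr => s _.
by rewrite -ww -tt.
Qed.

Lemma wedge_exp_comp (W : vectType R) (f : V -> W) k
    (w : Defs.form V k) (w' : Defs.form W k) m :
  (forall v, w' (f \o v) = w v) ->
  forall v, wedge_exp w' m (f \o v) = wedge_exp w m v.
Proof. by move=> ww; elim: m => // m IHm; apply: wedge_comp. Qed.

End MultilinearForms.

(** * Inner derivations and their exponential series *)

Section CoadjointOrbit.
Variables (R : numFieldType) (g : lieAlgType R).
Implicit Types (x y z u v : g) (alpha beta : 'Hom(g, R^o)).

HB.instance Definition _ x :=
  GRing.isLinear.Build R g g *:%R (lie x) (fun a u v => lie_linearr a u v x).

Lemma lieC x y : lie x y = - lie y x.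
Proof.
have := liexx (x + y); rewrite linearD /= -[x in lie (x + y)]scale1r.
rewrite !lie_linearl !scale1r !liexx add0r addr0 addrC => /eqP.
by rewrite addr_eq0 => /eqP.
Qed.

Lemma lie_derivation x u v :
  lie x (lie u v) = lie (lie x u) v + lie u (lie x v).
Proof.
have /eqP := lie_jacobi x u v; rewrite -addrA addr_eq0 => /eqP ->.
by rewrite opprD addrC (lieC v) opprK [lie v x]lieC linearN opprK.
Qed.

Lemma lie_lower_central k x y :
  y \in lower_central g k -> lie x y \in lower_central g k.+1.
Proof. by move=> yk; apply: memv_lie (memvf x) yk. Qed.

Lemma lower_central_dec k : (lower_central g k.+1 <= lower_central g k)%VS.
Proof.
elim: k => [|k IHk]; first exact: subvf.
by apply/lievP => x y _ yk; apply/lie_lower_central/(subvP IHk).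
Qed.

Lemma iter_lie_lower_central j k x y :
  y \in lower_central g k -> iter j (lie x) y \in lower_central g (j + k).
Proof. by move=> yk; elim: j => //= j; apply: lie_lower_central. Qed.

Lemma iterS_lie_lower_central j k x y :
  y \in lower_central g k -> iter j.+1 (lie x) y \in lower_central g k.+1.
Proof.
move=> yk; elim: j => [|j IHj]; first exact: lie_lower_central.
by apply: (subvP (lower_central_dec _)); apply: lie_lower_central.
Qed.

(** The divided power (ad x)^k / k!, for which the Leibniz rule has no binomial coefficients. *)
Definition dpow_ad x k u : g := (k`!%:R)^-1 *: iter k (lie x) u.

Lemma lie_dpow_ad x k u : lie x (dpow_ad x k u) = k.+1%:R *: dpow_ad x k.+1 u.
Proof.
rewrite /dpow_ad linearZ /= scalerA factS natrM invfM mulrA divff ?mul1r //.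
by rewrite pnatr_eq0.
Qed.

Lemma dpow_ad_lie x k u v : dpow_ad x k (lie u v) =
  \sum_(i < k.+1) lie (dpow_ad x i u) (dpow_ad x (k - i) v).
Proof.
elim: k => [|k IHk].
  by rewrite big_ord1 /dpow_ad /= fact0 invr1 !scale1r.
have k0 : k.+1%:R != 0 :> R by rewrite pnatr_eq0.
apply: (scalerI k0); rewrite -lie_dpow_ad IHk linear_sum /=.
under eq_bigr do rewrite lie_derivation !lie_dpow_ad lieZl lieZr.
rewrite big_split /= scaler_sumr.
(* Splitting the factor [k + 1] as [i + (k + 1 - i)] separates the terms where [ad x] hits the first
   factor from those where it hits the second. *)
have sp (i : 'I_k.+2) : k.+1%:R = i%:R + (k.+1 - i)%:R :> R.
  by rewrite -natrD subnKC // -ltnS.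
under [RHS]eq_bigr => i _ do rewrite (sp i) scalerDl.
rewrite big_split /=; congr (_ + _).
  by rewrite [RHS]big_ord_recl mulr0n scale0r add0r.
rewrite [RHS]big_ord_recr /= subnn mulr0n scale0r addr0.
by apply: eq_bigr => i _; rewrite subSn // -ltnS.
Qed.

(** The exponential series of ad x cut after order [N]; it is the full exponential once
    [lower_central g N] vanishes. *)
Definition exp_ad N x : 'End(g) :=
  \sum_(k < N.+1) (k`!%:R)^-1 *: iter k (fun f => linfun (lie x) \o f)%VF \1%VF.

Lemma exp_adE N x u : exp_ad N x u = \sum_(k < N.+1) dpow_ad x k u.
Proof.
rewrite sum_lfunE; apply: eq_bigr => k _; rewrite scale_lfunE; congr (_ *: _).
by elim: (k : nat) => [|j IHj]; rewrite /= ?id_lfunE // comp_lfunE lfunE IHj.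
Qed.

Lemma exp_adS N x u :
  exp_ad N x u = u + \sum_(k < N) (k.+1`!%:R)^-1 *: iter k.+1 (lie x) u.
Proof.
by rewrite exp_adE big_ord_recl /dpow_ad /= fact0 invr1 scale1r.
Qed.

Lemma exp_ad_central N x z : lie x z = 0 -> exp_ad N x z = z.
Proof.
move=> xz; rewrite exp_adS big1 ?addr0 // => k _.
rewrite iterSr xz; suff -> : iter k (lie x) 0 = 0 by rewrite scaler0.
by elim: (k : nat) => //= j ->; rewrite lie0r.
Qed.

(** * The exponential as an automorphism of a nilpotent Lie algebra *)

Section Nilpotent.
Variables (N : nat) (nilp : lower_central g N = 0%VS).

Lemma iter_lie0 x k u : (N <= k)%N -> iter k (lie x) u = 0.
Proof.
move=> /subnK <-; rewrite iterD; elim: (k - N)%N => [|j IHj] /=.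
  have := iter_lie_lower_central N x (memvf u : u \in lower_central g 0).
  by rewrite addn0 nilp memv0 => /eqP.
by rewrite IHj lie0r.
Qed.

Lemma dpow_ad0 x k u : (N <= k)%N -> dpow_ad x k u = 0.
Proof. by move=> Nk; rewrite /dpow_ad iter_lie0 ?scaler0. Qed.

Lemma exp_ad_widen M x u :
  (N <= M)%N -> exp_ad N x u = \sum_(k < M) dpow_ad x k u.
Proof.
move=> NM; rewrite exp_adE big_ord_recr /= dpow_ad0 // addr0.
rewrite -!(big_mkord xpredT (fun k => dpow_ad x k u)).
rewrite [RHS](big_cat_nat (n := N)) //=.
rewrite [X in _ + X]big_nat_cond [X in _ + X]big1 ?addr0 //.
by move=> k /andP[/andP[Nk _] _]; rewrite dpow_ad0.
Qed.

(** By the Leibniz rule this is a Cauchy product of series; with [N + N] orders no nonzero product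
    of terms is cut off. *)
Lemma exp_ad_lie x u v :
  exp_ad N x (lie u v) = lie (exp_ad N x u) (exp_ad N x v).
Proof.
rewrite (exp_ad_widen _ _ (leq_addr N N)).
rewrite (exp_ad_widen x u (leq_addr N N)) lie_suml.
under eq_bigr => k _ do rewrite dpow_ad_lie.
under eq_bigr => k _ do rewrite (big_ord_widen_cond (N + N) xpredT
  (fun i => lie (dpow_ad x i u) (dpow_ad x (k - i) v))) //=.
rewrite (exchange_big_dep xpredT) //=; apply: eq_bigr => i _.
(* Both sides vanish for [i >= N]; otherwise at least [N] orders remain for [v], enough for its full
   exponential. *)
have [Ni|iN] := leqP N i.
  by rewrite dpow_ad0 // lie0l big1 // => k _; rewrite lie0l.
rewrite (@exp_ad_widen (N + N - i)) ?lie_sumr; last first.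
  by rewrite -addnBA ?leq_addr // ltnW.
rewrite -(big_mkord xpredT (fun j => lie (dpow_ad x i u) (dpow_ad x j v))).
rewrite -(big_mkord (fun k => i < k.+1)%N
  (fun k => lie (dpow_ad x i u) (dpow_ad x (k - i) v))).
have iNN : (i <= N + N)%N by rewrite ltnW.
rewrite (big_cat_nat (n := i)) //= big_nat_cond big_pred0 ?Monoid.mul1m;
  last first.
  by move=> k; rewrite ltnS; case: ltnP => //; rewrite andbF.
rewrite -{1}[i : nat]add0n big_addn; apply: congr_big_nat => // k.
  by rewrite ltnS leq_addl.
by rewrite addnK.
Qed.

(** A kernel vector is minus a combination of iterated brackets with [x], so it descends the lower
    central series step by step down to zero. *)
Lemma exp_ad_inj x : lker (exp_ad N x) == 0%VS.
Proof.
apply/eqP; apply/vspaceP => u; rewrite memv_ker memv0.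
apply/eqP/eqP => [Eu|->]; last first.
  exact: linear0.
suff: u \in lower_central g N by rewrite nilp memv0 => /eqP.
elim: N => [|k IHk]; first exact: memvf.
have : u = - \sum_(j < N) (j.+1`!%:R)^-1 *: iter j.+1 (lie x) u.
  by apply/eqP; rewrite -addr_eq0 -exp_adS Eu.
move=> ->; rewrite rpredN rpred_sum // => j _; apply: memvZ.
exact: iterS_lie_lower_central.
Qed.

End Nilpotent.

(** * Transitivity of the coadjoint action *)

Lemma rad_solve alpha beta z :
    (forall y, lie z y = 0) -> alpha z != 0 ->
    (forall x, (forall y, alpha (lie x y) = 0) -> x \in <[z]>%VS) ->
    beta z = 0 ->
  exists x, forall y, alpha (lie x y) = beta y.
Proof.
move=> zC az rad bz.
pose B x : 'Hom(g, R^o) := (alpha \o linfun (lie x))%VF.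
have BE x y : B x y = alpha (lie x y) by rewrite comp_lfunE lfunE.
have B_lin : linear B.
  move=> a u v; apply/lfunP => y; rewrite add_lfunE scale_lfunE !BE lie_linearl.
  by rewrite linearP.
pose BL := GRing.isLinear.Build _ _ _ _ B B_lin.
pose Bl : {linear g -> 'Hom(g, R^o)} := HB.pack B BL.
pose ev (f : 'Hom(g, R^o)) : R^o := f z.
have ev_lin : linear ev by move=> a f h; rewrite /ev add_lfunE scale_lfunE.
pose EL := GRing.isLinear.Build _ _ _ _ ev ev_lin.
pose evl : {linear 'Hom(g, R^o) -> R^o} := HB.pack ev EL.
(* As [z] is central, every form [alpha o ad x] lies in the hyperplane of forms vanishing at [z]. *)
have sub : (limg (linfun Bl) <= lker (linfun evl))%VS.
  apply/subvP => f /memv_imgP[x _ ->]; rewrite memv_ker !lfunE /= /ev BE.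
  by rewrite lieC zC oppr0 linear0.
have kB : (lker (linfun Bl) <= <[z]>)%VS.
  apply/subvP => x; rewrite memv_ker lfunE /= => /eqP Bx; apply: rad => y.
  by rewrite -BE Bx lfunE.
have dimH : \dim {:'Hom(g, R^o)} = \dim {:g} by rewrite !dimvf /dim /= muln1.
have dB := limg_ker_dim (linfun Bl) fullv.
have dev := limg_ker_dim (linfun evl) fullv.
have z0 : z != 0 by apply: contraNneq az => ->; rewrite linear0.
have d1 := dimvS kB; rewrite dim_vline z0 in d1.
have d2 : (0 < \dim (limg (linfun evl)))%N.
  rewrite lt0n dimv_eq0; apply: contraNneq az => e0.
  have : linfun evl alpha \in limg (linfun evl) by rewrite memv_img ?memvf.
  by rewrite e0 memv0 lfunE.
(* Dimension count: [Bl] has kernel of dimension at most 1 and evaluation at [z] has rank at least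
   1, so the image of [Bl] fills the hyperplane. *)
have /eqP eqV : limg (linfun Bl) == lker (linfun evl).
  rewrite eqEdim sub andTb; move: dB dev; rewrite !capfv dimH => dB dev.
  rewrite -(leq_add2r (\dim (limg (linfun evl)))) dev -dB addnC leq_add2l.
  exact: leq_trans d1 d2.
have : beta \in limg (linfun Bl) by rewrite eqV memv_ker lfunE /= /ev bz.
by case/memv_imgP => x _ ->; exists x => y; rewrite lfunE /= BE.
Qed.

(* Moving alpha by exp (ad x), where alpha o ad x = beta - alpha, improves the
   agreement of alpha with beta from C^(k+1) to C^k: on C^k the terms of order
   at least two of the exponential series are alpha - beta evaluated on
   C^(k+1). *)
Lemma coadjoint_transitive N z beta k alpha :
    lower_central g N = 0%VS -> (forall y, lie z y = 0) -> alpha z != 0 ->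
    (forall x, (forall y, alpha (lie x y) = 0) -> x \in <[z]>%VS) ->
    beta z = alpha z ->
    {in lower_central g k, alpha =1 beta} ->
  exists phi : 'End(g), [/\ lker phi == 0%VS,
    forall x y, phi (lie x y) = lie (phi x) (phi y) & (alpha \o phi)%VF = beta].
Proof.
move=> nilp zC; elim: k alpha => [|k IHk] alpha az rad bz agree.
  exists \1%VF; split.
    by apply/lker0P => u v; rewrite !id_lfunE.
    by move=> x y; rewrite !id_lfunE.
  by rewrite comp_lfun1r; apply/lfunP => y; apply: agree; apply: memvf.
have [|x xP] := rad_solve (beta := beta - alpha) zC az rad.
  by rewrite add_lfunE opp_lfunE bz subrr.
pose E := exp_ad N x.
have Ez : E z = z by apply: exp_ad_central; rewrite lieC zC oppr0.
have kE : lker E == 0%VS := exp_ad_inj nilp x.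
have [||||phi [kphi phi_lie phiE]] := IHk (alpha \o E)%VF.
- by rewrite comp_lfunE Ez.
(* The automorphism [E] maps the radical of [alpha \o E] into that of [alpha], which lies in the
   line of [z], and [E] fixes [z]. *)
- move=> u uP; have /vlineP[c Eu] : E u \in <[z]>%VS.
    apply: rad => y; rewrite -[y](lker0_lfunVK kE) -exp_ad_lie //.
    by rewrite -comp_lfunE uP.
  apply/vlineP; exists c; apply: (lker0P kE).
  by rewrite linearZ /= Ez.
- by rewrite comp_lfunE Ez.
- move=> y yk; rewrite comp_lfunE exp_adS linearD linear_sum /=.
  have -> : beta y = alpha y + alpha (lie x y).
    by rewrite xP add_lfunE opp_lfunE addrC subrK.
  congr (_ + _).
  have high j : alpha (iter j.+2 (lie x) y) = 0.
    rewrite iterS xP add_lfunE opp_lfunE agree ?subrr //.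
    exact: iterS_lie_lower_central.
  (* For [N = 0] the algebra is zero and the series has no first-order term to extract. *)
  case: N nilp @E Ez kE => [|M] nilp *.
    have := memvf (lie x y); rewrite -[fullv]/(lower_central g 0) nilp memv0.
    by move=> /eqP ->; rewrite big_ord0 linear0.
  rewrite big_ord_recl /= factS fact0 invr1 scale1r big1 ?addr0 // => j _.
  by rewrite linearZ /= high scaler0.
exists (E \o phi)%VF; split.
- by apply/lker0P => u v; rewrite !comp_lfunE => /(lker0P kE)/(lker0P kphi).
- by move=> u v; rewrite !comp_lfunE phi_lie exp_ad_lie.
- by rewrite comp_lfunA.
Qed.

End CoadjointOrbit.

(** * Contact forms on nilpotent Lie algebras *)

Section ContactForms.
Variables (R : numFieldType).

(** Vectors on which the top form of [alpha] is nonzero are carried by [phi] to such vectors for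
    [beta]. *)
Lemma contact_form_iso p (g1 g2 : lieAlgType R) (phi : 'Hom(g1, g2))
    (alpha : 'Hom(g1, R^o)) (beta : 'Hom(g2, R^o)) :
  (forall x y, phi (lie x y) = lie (phi x) (phi y)) ->
  (beta \o phi)%VF = alpha -> \dim {:g2} = \dim {:g1} ->
  contact_form p alpha -> contact_form p beta.
Proof.
move=> phi_lie <- dim12 [dim1 [v wv]]; split; first by rewrite dim12.
exists (phi \o v); rewrite (wedge_comp (w := form1 (beta \o phi)%VF)
  (t := wedge_exp (d1 (beta \o phi)%VF) p)) //.
  by move=> u; rewrite /form1 /= comp_lfunE.
by apply: wedge_exp_comp => u; rewrite /d1 /= comp_lfunE phi_lie.
Qed.

Variable g : lieAlgType R.
Implicit Types (alpha beta : 'Hom(g, R^o)) (x y z : g).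

Lemma form1_multilinear alpha : multilinear (form1 alpha).
Proof. by move=> v i c x y; rewrite /form1 /upd (ord1 i) eqxx linearP. Qed.

Lemma d1_multilinear alpha : multilinear (d1 alpha).
Proof.
move=> v i c x y; rewrite /d1 /upd; have [->|i0] := eqVneq i ord0.
  by rewrite /= lie_linearl linearP /= mulrN opprD.
have -> : i = ord_max by apply: val_inj; case: i i0 => [[|[]]].
by rewrite /= lie_linearr linearP /= mulrN opprD.
Qed.

(** Contraction with such an [x] kills alpha and d alpha, hence their top product, a nonzero
    alternating form whose degree is dim g. *)
Lemma contact_form_nondegenerate p alpha x : contact_form p alpha ->
  (forall y, alpha (lie x y) = 0) -> alpha x = 0 -> x = 0.
Proof.
move=> [dim_g [v wv]] rx ax.
apply: (@alternating_kills_eq0 R g _ _ x v _ _ _ _ wv).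
- apply/wedge_multilinear/wedge_exp_multilinear/d1_multilinear.
  exact: form1_multilinear.
- exact: wedge_alternating.
- apply: wedge_kills; first by move=> u i; rewrite /form1 (ord1 i) => ->.
  apply: wedge_exp_kills => u i ui; rewrite /d1.
  have [i0|i0] := eqVneq i ord0; first by rewrite -i0 ui rx oppr0.
  have <- : i = ord_max by apply: val_inj; case: i i0 {ui} => [[|[]]].
  by rewrite ui lieC linearN /= rx !oppr0.
- by rewrite dim_g add1n mulnC.
Qed.

Lemma nilpotent_contact_form_iso p N z alpha beta :
    lower_central g N = 0%VS -> z != 0 -> (forall y, lie z y = 0) ->
    contact_form p alpha -> beta z = alpha z ->
  contact_form p beta /\ contacto_isomorphic alpha beta.
Proof.
move=> nilp z0 zC ct bz.
(* Otherwise [z] would lie in both ker alpha and the radical of d alpha. *)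
have az : alpha z != 0.
  apply: contra_neq z0; apply: contact_form_nondegenerate ct _ => y.
  by rewrite zC linear0.
have rad x : (forall y, alpha (lie x y) = 0) -> x \in <[z]>%VS.
  (* This coefficient [c] puts [x - c z] in ker alpha, and centrality of [z] keeps it in the
     radical. *)
  move=> rx; apply/vlineP; exists (alpha x / alpha z); apply/eqP.
  rewrite -subr_eq0 addrC -scaleNr; apply/eqP.
  apply: (contact_form_nondegenerate ct).
    by move=> y; rewrite lie_linearl zC scaler0 add0r rx.
  by rewrite linearP /= scaleNr /GRing.scale /= divfK // addNr.
(* The induction starts at C^N = 0, where any two forms agree. *)
have [|phi [kphi phi_lie phiE]] :=
  coadjoint_transitive (k := N) nilp zC az rad bz.
  by move=> y; rewrite nilp memv0 => /eqP ->; rewrite !linear0.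
(* [phi] pulls alpha back to beta, while a contacto-isomorphism from alpha to beta must pull beta
   back to alpha. *)
pose psi := (phi^-1)%VF.
have psi_lie x y : psi (lie x y) = lie (psi x) (psi y).
  by apply: (lker0P kphi); rewrite phi_lie !lker0_lfunVK.
have psiE : (beta \o psi)%VF = alpha by rewrite -phiE lker0_compfK.
split; first exact: contact_form_iso psi_lie psiE erefl ct.
exists psi; split => //.
exact: Bijective (lker0_lfunVK kphi) (lker0_lfunK kphi).
Qed.

(** In [X_i, X_n] the [mu0] part is zero, its nonzero brackets stopping at X_{n-1}; and [r > 2k + 1]
    on [Delta] pushes the index i + n + r - 2k - 1 beyond n. *)
Lemma adapted_basis_central n (X : n.+1.-tuple g) y :
  (0 < n)%N -> adapted_basis X -> lie X`_n y = 0.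
Proof.
move=> n0 [basX [c cX]]; rewrite (coord_basis basX (memvf y)).
rewrite lie_sumr big1 // => i _; rewrite lieZr lieC.
have -> : X`_n = X`_(@ord_max n) by [].
rewrite cX /mu0 /= (gtn_eqF n0) big1 ?addr0 => [|k _]; last first.
  apply: big1 => r /and3P[_ /andP[kr _] _]; rewrite /Psi /Psi_lt.
  case: ltnP => _; last by rewrite ltnNge leq_ord /= scaler0.
  case: ifP => [/and3P[_ _]|_]; last by rewrite scaler0.
  by rewrite -subnDA leq_subLR => le; exfalso; move: kr le; lia.
by rewrite andFb ifF ?oppr0 ?scaler0 //; apply/negP => /and3P[_ _]; lia.
Qed.

End ContactForms.

Theorem theorem2p8 (R : realType) (p : nat) (g : lieAlgType R)
    (dim_g : \dim {:g} = (2 * p).+1) (filiform_g : filiform g)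
    (X : (2 * p).+1.-tuple g) (adapted_X : adapted_basis X)
    (al : 'I_(2 * p).+1 -> 'Hom(g, R^o)) (dual_al : dual_basis X al)
    (a : 'I_(2 * p).+1 -> R) :
  let alpha := \sum_(i < (2 * p).+1) a i *: al i in
  let beta := a ord_max *: al ord_max in
  contact_form p alpha ->
  contact_form p beta /\ contacto_isomorphic alpha beta.
Proof.
move=> alpha beta ct; have [dim3 dimC] := filiform_g.
have p0 : (0 < 2 * p)%N by move: dim3; rewrite dim_g; lia.
(* Here m = 2p + 1, so k = 2p gives dimension m - k - 1 = 0. *)
have nilp : lower_central g (2 * p) = 0%VS.
  by apply/eqP; rewrite -dimv_eq0 dimC dim_g; [apply/eqP|]; lia.
apply: (nilpotent_contact_form_iso nilp (z := X`_(@ord_max (2 * p)))) => //.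
- have [basX _] := adapted_X; apply: free_not0 (basis_free basX) _.
  by rewrite mem_nth // size_tuple.
- by move=> y; apply: adapted_basis_central.
(* By duality only the last term of [alpha] survives at X_{2p}. *)
rewrite sum_lfunE scale_lfunE (bigD1 ord_max) //= big1 ?addr0 => [|i ni].
  by rewrite scale_lfunE.
by rewrite scale_lfunE [al i _](dual_al i ord_max) (negPf ni) scaler0.
Qed.
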